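(* Let $f$ be an $S$-perfect structure over the $q$-ary $n$-cube $H_q^n$. Let $p<q$ be a positive integer, and let $f_0$ be the sum of $f$ over the vertices of the $p$-ary subcube $H_p^n\subset H_q^n$. Then the weight distribution of $f$ with respect to $V(H_p^n)$ is $$(f_0=f_0\Pi_0(S'),\ f_0\Pi_1(S'),\ \dots,\ f_0\Pi_n(S'))^{T},$$ where $S'=(S-(p-1)nI)/p$, $\Pi_i(\cdot)=P_i(P_1^{-1}(\cdot))$, and $P_i(x)=P_i(x;n,\frac qp)$ are the Krawtchouk polynomials. The corresponding weight enumerator equals $f_0\,Z_{S';n,\frac qp}(z)$.
   Context: The $q$-ary $n$-cube $H_q^n$ is the graph whose vertices are all words of length $n$ over $\{0,\dots,q-1\}$, two words being adjacent iff they differ in exactly one position. With $A$ its adjacency matrix and $S$ a real $\nu\times\nu$ matrix, an $S$-perfect structure over $H_q^n$ is a real $q^n\times\nu$ matrix $f$ with $Af=fS$, regarded also as a function on vertices with values the rows of $f$. The subcube $H_p^n$ has as vertices the words of length $n$ over the subalphabet $\{0,\dots,p-1\}$. The weight distribution of $f$ with respect to a vertex set $C$ is $(h_0,\dots,h_{\rho})^T$, where $h_w$ is the sum of $f(v)$ over all vertices $v$ at distance $w$ from $C$ (distance in $H_q^n$) and $\rho$ is the maximum distance of a vertex from $C$; the corresponding weight enumerator is $h_0+zh_1+\dots+z^{\rho}h_\rho$, $z$ a real variable. Krawtchouk polynomials, for a (not necessarily integer) real parameter $Q>1$: $P_w(x;n,Q)=\sum_{j=0}^w(-1)^j(Q-1)^{w-j}\binom{x}{j}\binom{n-x}{w-j}$;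 in particular $P_1(x;n,Q)=(Q-1)n-Qx$, so $P_1^{-1}(y)=((Q-1)n-y)/Q$, and $P_i(P_1^{-1}(\cdot))$ is a polynomial, which can be evaluated at a square matrix. $Z_{M;n,Q}(z)=(1-z)^{((Q-1)nI-M)/Q}(1+(Q-1)z)^{(nI+M)/Q}$ for a square matrix $M$, where $I$ is the identity matrix and $t^X=\exp(X\ln t)$ for real $t>0$; the formula is understood for real $z$ with $1-z>0$ and $1+(Q-1)z>0$. *)

(* Defs.v *)
From HB Require Import structures.
From mathcomp Require Import all_boot all_order all_algebra.
From mathcomp Require Import all_classical all_reals all_analysis.

Set Implicit Arguments.
Unset Strict Implicit.
Unset Printing Implicit Defensive.

Import Order.TTheory GRing.Theory Num.Theory.
Import numFieldNormedType.Exports.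

Local Open Scope ring_scope.

Section Graph.
Variables (T : finType) (e : rel T).

Definition walk (k : nat) (x y : T) : bool :=
  [exists t : k.-tuple T, path e x t && (last x t == y)].

(* The length of a shortest walk from x to y; since such a walk has fewer than
   #|T| edges, the value is #|T| exactly when y is unreachable from x. *)
Definition gdist (x y : T) : nat := find (fun k => walk k x y) (iota 0 #|T|).

Definition set_dist (C : {set T}) (x : T) : nat :=
  \big[minn/#|T|]_(y in C) gdist x y.

Definition covering_radius (C : {set T}) : nat := (\max_(x : T) set_dist C x)%N.

Variables (R : realType) (nu : nat).

Definition adjmx : 'M[R]_#|T| :=
  \matrix_(i, j) (e (enum_val i) (enum_val j))%:R.

Definition perfect_structure (S : 'M[R]_nu) (f : 'M[R]_(#|T|, nu)) : Prop :=
  adjmx *m f = f *m S.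

Definition at_vertex (f : 'M[R]_(#|T|, nu)) (v : T) : 'rV[R]_nu :=
  row (enum_rank v) f.

Definition weight_distribution (C : {set T}) (f : 'M[R]_(#|T|, nu)) :
    seq 'rV[R]_nu :=
  [seq \sum_(v | set_dist C v == w) at_vertex f v
     | w <- iota 0 (covering_radius C).+1].

Definition weight_enumerator (C : {set T}) (f : 'M[R]_(#|T|, nu)) (z : R) :
    'rV[R]_nu :=
  let h := weight_distribution C f in \sum_(w < size h) z ^+ w *: h`_w.

End Graph.

Notation word q n := {ffun 'I_n -> 'I_q}.

Definition cube_adj (q n : nat) : rel (word q n) :=
  [rel x y : word q n | #|[pred i | x i != y i]| == 1%N].

Definition subcube (p q n : nat) : {set word q n} :=
  [set x : word q n | [forall i, (x i < p)%N]]%SET.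

Section Krawtchouk.
Variable R : realType.

(* binomial coefficient 'X choose j *)
Definition binp (j : nat) : {poly R} :=
  (j`!%:R)^-1 *: \prod_(k < j) ('X - k%:R%:P).

Definition krawtchouk (w n : nat) (Q : R) : {poly R} :=
  \sum_(j < w.+1) ((-1) ^+ j * (Q - 1) ^+ (w - j)) *:
    (binp j * (binp (w - j) \Po (n%:R%:P - 'X))).

(* the compositional inverse of krawtchouk 1 n Q = (Q - 1) n - Q 'X *)
Definition krawtchouk1_inv (n : nat) (Q : R) : {poly R} :=
  Q^-1 *: (((Q - 1) * n%:R)%:P - 'X).

Definition Pi_poly (i n : nat) (Q : R) : {poly R} :=
  krawtchouk i n Q \Po krawtchouk1_inv n Q.

End Krawtchouk.

Section MatrixFunctions.
Variables (R : realType) (nu : nat).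
Implicit Type M : 'M[R]_nu.+1.

Definition expmx M : 'M[R]_nu.+1 :=
  limn (series (fun k : nat => (k`!%:R)^-1 *: M ^+ k)).

Definition powmx (t : R) M : 'M[R]_nu.+1 := expmx (ln t *: M).

Definition Zmx M (n : nat) (Q z : R) : 'M[R]_nu.+1 :=
  powmx (1 - z) (Q^-1 *: (((Q - 1) * n%:R)%:M - M)) *m
  powmx (1 + (Q - 1) * z) (Q^-1 *: (n%:R%:M + M)).

End MatrixFunctions.

(* Main.v *)
Require Import Defs.
From HB Require Import structures.
From mathcomp Require Import all_boot all_order all_algebra.
From mathcomp Require Import all_classical all_reals all_analysis.
From mathcomp Require Import ring.
Set Implicit Arguments.
Unset Strict Implicit.
Unset Printing Implicit Defensive.
Import Order.TTheory GRing.Theory Num.Theory.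
Import numFieldNormedType.Exports.
Local Open Scope ring_scope.

(** Everything is a spectral decomposition in the q-ary cube, with r = Q - 1.
    On the alphabet, the function equal to r on the first p letters and to -1
    on the others has sum 0, because p r = q - p; hence it is an eigenfunction
    of the complete graph K_q. For a set K of coordinates, let chi_K be the
    product of its copies over the coordinates in K. As the cube is a
    Cartesian power of K_q, chi_K is an eigenfunction of its adjacency matrix,
    with eigenvalue (q - 1) n - q |K| ([subcube_char_eigen]). Since A f = f S
    with A symmetric, the vector sum_v chi_K(v) f(v) is then a left
    eigenvector of S, and so of S', where its eigenvalue is (Q - 1) n - Q |K|
    = P_1(|K|) ([char_component_eigen]).

    The distance from a word v to the subcube is the number wt(v) of its
    letters that are at least p ([set_dist_subcube]), so X^wt(v) is a product
    over the coordinates as well, and writing each factor in the basis (1 - X,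
    1 + r X) gives ([weight_monomialE])

      X^wt(v) = Q^-n sum_K chi_K(v) (1 - X)^|K| (1 + r X)^(n - |K|).

    Multiplying by f(v) and summing over v, with g_K the multiple by Q^-n of
    sum_v chi_K(v) f(v), gives

      sum_v X^wt(v) f(v) = sum_K (1 - X)^|K| (1 + r X)^(n - |K|) g_K.

    At X = 0 this is f0 = sum_K g_K. Both claims now hold one eigenvector at a
    time: the coefficient of X^w in (1 - X)^k (1 + r X)^(n - k) is the
    Krawtchouk value P_w(k), which is what Pi_w(S') does to g_K when |K| = k
    ([horner_Pi_poly]), and at X = z the same product is what Z_{S'}(z) does
    to g_K ([eigenvector_Zmx]), because a matrix exponential acts on an
    eigenvector as the scalar exponential of the eigenvalue.
*)

(** * Distance to a subcube *)

Section Distance.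
Local Open Scope nat_scope.

Lemma walkS (T : finType) (e : rel T) k x y :
  walk e k.+1 x y = [exists z, e x z && walk e k z y].
Proof.
apply/existsP/existsP => [[t]|[z /andP[exz /existsP[t /andP[et /eqP lt]]]]].
  case/tupleP: t => z t /= /andP[/andP[exz et] lt].
  by exists z; rewrite exz; apply/existsP; exists t; rewrite et.
by exists [tuple of z :: t]; rewrite /= exz et lt eqxx.
Qed.

Variables (q n : nat).
Implicit Types x y z : word q n.

Definition hamming x y := #|[pred i | x i != y i]|.

Lemma hammingE x y : hamming x y = \sum_i (x i != y i).
Proof. by rewrite /hamming -sum1_card -big_mkcond. Qed.

Lemma hamming_triangle x y z : hamming x z <= hamming x y + hamming y z.
Proof.
rewrite !hammingE -big_split; apply: leq_sum => i _ /=.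
by have [->|_] := eqVneq (x i) (y i); [rewrite add0n | case: (x i != z i)].
Qed.

Lemma hamming_eq0 x y : (hamming x y == 0) = (x == y).
Proof.
rewrite hammingE sum_nat_eq0.
apply/forallP/eqP => [xy|-> i]; last by rewrite eqxx.
by apply/ffunP => i; apply/eqP; have := xy i; case: (x i == y i).
Qed.

Lemma hamming_le x y : hamming x y <= n.
Proof. by rewrite -[leqRHS]card_ord; apply: max_card. Qed.

Lemma walk_hamming k x y : walk (@cube_adj q n) k x y -> hamming x y <= k.
Proof.
elim: k x => [|k IH] x.
  case/existsP=> t; rewrite (tuple0 t) /= => /eqP ->.
  by rewrite leqn0 hamming_eq0.
rewrite walkS => /existsP[z /andP[/eqP xz /IH zy]].
by apply: leq_trans (hamming_triangle x z y) _; rewrite {1}/hamming xz.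
Qed.

(** A shortest walk replaces the letters of [x] that differ from those of [y]
    one at a time. *)
Lemma hamming_walk x y : walk (@cube_adj q n) (hamming x y) x y.
Proof.
move def_k: (hamming x y) => k.
elim: k x def_k => [|k IH] x hxy.
  apply/existsP; exists [tuple]; rewrite /=.
  by rewrite -hamming_eq0 hxy.
have /card_gt0P[i] : 0 < hamming x y by rewrite hxy.
rewrite inE => xyi.
pose x' : word q n := [ffun j => if j == i then y i else x j].
have eq_sum z : hamming z y = (z i != y i) + \sum_(j | j != i) (z j != y j).
  by rewrite hammingE (bigD1 i).
rewrite walkS; apply/existsP; exists x'; rewrite IH ?andbT.
  rewrite /cube_adj /= -/(hamming x x') hammingE (bigD1 i) //= !ffunE eqxx xyi.
  by rewrite big1 // => j /negPf ji; rewrite !ffunE ji eqxx.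
apply/eqP; rewrite -eqSS -hxy eq_sum (eq_sum x) xyi !ffunE !eqxx /=.
by apply/eqP; congr _.+1; apply: eq_bigr => j /negPf ji; rewrite ffunE ji.
Qed.

Lemma find_iota0 (a : pred nat) (N d : nat) :
  d < N -> a d -> (forall k, a k -> d <= k) -> find a (iota 0 N) = d.
Proof.
move=> dN ad min_d; have has_a : has a (iota 0 N).
  by apply/hasP; exists d; rewrite // mem_iota.
have ltN : find a (iota 0 N) < N by move: has_a; rewrite has_find size_iota.
apply/eqP; rewrite eqn_leq; apply/andP; split.
  rewrite leqNgt; apply/negP => /(before_find 0).
  by rewrite nth_iota // ad.
by have := nth_find 0 has_a; rewrite nth_iota // => /min_d.
Qed.

(** The hypothesis [1 < q] puts the Hamming distance, at most [n], strictly
    below the number [q ^ n] of words, up to which the definition of the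
    distance searches for walks. *)
Lemma gdist_cube x y : 1 < q -> gdist (@cube_adj q n) x y = hamming x y.
Proof.
move=> q_gt1; apply: find_iota0.
- apply: leq_ltn_trans (hamming_le x y) _.
  by rewrite card_ffun !card_ord ltn_expl.
- exact: hamming_walk.
- by move=> k; exact: walk_hamming.
Qed.

Lemma bigminn_eq (I : finType) (C : {set I}) (F : I -> nat) (N d : nat) i0 :
  i0 \in C -> F i0 = d -> d <= N -> (forall i, i \in C -> d <= F i) ->
  \big[minn/N]_(i in C) F i = d.
Proof.
move=> Ci0 Fi0 dN dF; apply/eqP; rewrite eqn_leq; apply/andP; split.
  by rewrite -minEnat -leEnat -Fi0; exact: bigmin_le_cond.
elim/big_ind: _ => // [a b da db]; by rewrite leq_min da.
Qed.

Definition weight (p : nat) x := #|[pred i | p <= x i]|.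

Lemma weightE p x : weight p x = \sum_i (p <= x i).
Proof. by rewrite /weight -sum1_card -big_mkcond. Qed.

Lemma weight_le p x : weight p x <= n.
Proof. by rewrite -[leqRHS]card_ord; apply: max_card. Qed.

Lemma weight_eq0 p x : (weight p x == 0) = (x \in subcube p q n).
Proof.
rewrite inE weightE sum_nat_eq0.
by apply: eq_forallb => i; rewrite eqb0 -ltnNge.
Qed.

Variable p : nat.
Hypotheses (p_gt0 : 0 < p) (lt_pq : p < q).

(** A word of the subcube differs from [x] wherever [x] has a letter outside
    the subalphabet, and replacing exactly those letters by 0 reaches the
    subcube. *)
Lemma set_dist_subcube x :
  set_dist (@cube_adj q n) (subcube p q n) x = weight p x.
Proof.
have q_gt1 : 1 < q by exact: leq_ltn_trans lt_pq.
have q_gt0 : 0 < q by exact: ltn_trans q_gt1.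
pose y : word q n := [ffun i => if p <= x i then Ordinal q_gt0 else x i].
rewrite /set_dist; under eq_bigr do rewrite gdist_cube //.
apply: (bigminn_eq (i0 := y)).
- rewrite inE; apply/forallP => i; rewrite ffunE.
  by case: (leqP p (x i)).
- rewrite hammingE weightE; apply: eq_bigr => i _; rewrite ffunE.
  case: leqP => [pxi|_]; last by rewrite eqxx.
  by case: eqP => // xi0; move: pxi; rewrite xi0 leqNgt p_gt0.
- apply: leq_trans (weight_le p x) _.
  by rewrite card_ffun !card_ord ltnW // ltn_expl.
- move=> z; rewrite inE => /forallP zC; rewrite hammingE weightE.
  apply: leq_sum => i _; case: eqVneq => [xz|_]; last by case: (p <= x i).
  by have := zC i; rewrite xz ltnNge => /negPf ->.
Qed.

Lemma covering_radius_subcube :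
  covering_radius (@cube_adj q n) (subcube p q n) = n.
Proof.
rewrite /covering_radius; under eq_bigr do rewrite set_dist_subcube.
apply/eqP; rewrite eqn_leq; apply/andP; split.
  by apply/bigmax_leqP => x _; exact: weight_le.
pose x : word q n := [ffun=> Ordinal lt_pq].
suff {1}<- : weight p x = n by exact: leq_bigmax.
rewrite weightE (eq_bigr (fun=> 1)) ?sum1_card ?card_ord // => i _.
by rewrite ffunE /= leqnn.
Qed.

End Distance.

(** * Eigenfunctions of the cube *)

Section Eigenfunctions.

(** Associativity: if the row vector [chi] satisfies [chi A = theta chi], then
    [chi f S = chi A f = theta chi f]. *)
Lemma perfect_structure_eigen (T : finType) (e : rel T) (R : realType) nu
    (S : 'M[R]_nu) (f : 'M[R]_(#|T|, nu)) (chi : T -> R) (theta : R) :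
  perfect_structure e S f ->
  (forall v, \sum_(u | e u v) chi u = theta * chi v) ->
  (\sum_v chi v *: at_vertex f v) *m S
    = theta *: \sum_v chi v *: at_vertex f v.
Proof.
move=> fS chiE; pose c : 'rV[R]_#|T| := \row_i chi (enum_val i).
have -> : \sum_v chi v *: at_vertex f v = c *m f.
  rewrite mulmx_sum_row (reindex enum_rank) /=.
    by apply: eq_bigr => v _; rewrite mxE enum_rankK.
  by exists enum_val => v _; rewrite ?enum_rankK ?enum_valK.
have cA : c *m adjmx e R = theta *: c.
  apply/rowP => j; rewrite !mxE -chiE [RHS]big_mkcond /=.
  rewrite (reindex (@enum_val T T)) /=.
    apply: eq_bigr => i _; rewrite !mxE.
    by case: (e _ _); rewrite ?mulr1 ?mulr0.
  by exists enum_rank => v _; rewrite ?enum_rankK ?enum_valK.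
by rewrite -mulmxA -fS mulmxA cA -scalemxAl.
Qed.

Variables (R : comNzRingType) (q n : nat).

(** Adjacency as a sum of product functions: the cube is a Cartesian power
    of the complete graph, so two words are adjacent through exactly one
    coordinate. *)
Lemma cube_adjE (u v : word q n) :
  (cube_adj u v)%:R =
  \sum_i \prod_j (if j == i then u j != v j else u j == v j)%:R :> R.
Proof.
pose D := [set i | u i != v i]%SET.
have -> : cube_adj u v = (#|D| == 1%N).
  by rewrite /cube_adj /= cardsE.
transitivity (\sum_i (D == [set i]%SET)%:R : R).
  case: (boolP (#|D| == 1%N)) => [/cards1P[k ->]|].
    rewrite (bigD1 k) //= eqxx big1 ?addr0 // => i ik.
    case: eqP => // /setP/(_ k); rewrite !inE eqxx eq_sym => /esym/eqP ki.
    by rewrite ki eqxx in ik.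
  move=> D1; rewrite big1 // => i _; case: eqP => // Di.
  by rewrite Di cards1 in D1.
apply: eq_bigr => i _; case: eqP => [/setP Di|Di].
  rewrite big1 // => j _; have := Di j; rewrite !inE.
  by case: (j == i); case: (u j == v j).
case: (pickP [pred j | (j \in D) != (j == i)]) => [j /= Dj|Dj].
  rewrite (bigD1 j) //=; move: Dj; rewrite inE.
  by case: (j == i); case: (u j == v j); rewrite ?mul0r.
by case: Di; apply/setP => j; have /negbFE/eqP := Dj j; rewrite !inE => ->.
Qed.

(** In a Cartesian product of graphs, products of eigenfunctions are
    eigenfunctions and the eigenvalues add up. The hypothesis says that
    [psi i] is an eigenfunction of the complete graph on the alphabet. *)
Lemma cube_tensor_eigen (psi : 'I_n -> 'I_q -> R) (lambda : 'I_n -> R)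
    (v : word q n) :
  (forall i b, \sum_(c | c != b) psi i c = lambda i * psi i b) ->
  \sum_(u | cube_adj u v) \prod_i psi i (u i)
    = (\sum_i lambda i) * \prod_i psi i (v i).
Proof.
move=> psiE; rewrite big_mkcond /=.
transitivity (\sum_(u : word q n) \sum_i \prod_j
   ((if j == i then u j != v j else u j == v j)%:R * psi j (u j))).
  apply: eq_bigr => u _; transitivity ((cube_adj u v)%:R * \prod_i psi i (u i)).
    by rewrite /cube_adj /=; case: eqP; rewrite ?mul1r ?mul0r.
  rewrite cube_adjE big_distrl /=; apply: eq_bigr => i _.
  by rewrite big_split.
rewrite exchange_big big_distrl /=; apply: eq_bigr => i _.
rewrite -(bigA_distr_bigA (fun j c =>
  (if j == i then c != v j else c == v j)%:R * psi j c)).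
rewrite (bigD1 i) //= [in RHS](bigD1 i) //= mulrA -psiE; congr (_ * _).
  rewrite eqxx [RHS]big_mkcond; apply: eq_bigr => c _.
  by case: (c != v i); rewrite ?mul1r ?mul0r.
apply: eq_bigr => j /negPf ji; rewrite ji (bigD1 (v j)) //= eqxx mul1r.
by rewrite big1 ?addr0 // => c /negPf ->; rewrite mul0r.
Qed.

End Eigenfunctions.

(** * Krawtchouk polynomials at integers *)

Section KrawtchoukValues.
Variable R : realType.

Lemma horner_binp j m : (binp R j).[m%:R] = 'C(m, j)%:R.
Proof.
rewrite /binp hornerZ; apply: (canLR (mulKf _)).
  by rewrite pnatr_eq0 -lt0n fact_gt0.
rewrite -natrM mulnC bin_ffact horner_prod.
elim: j => [|j IH]; first by rewrite big_ord0 ffactn0.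
rewrite big_ord_recr /= IH ffactnSr natrM !hornerE.
have [jm|mj] := leqP j m; first by rewrite natrB.
by rewrite ffact_small // !mul0r.
Qed.

Lemma coef_linear_exp (c : R) m j :
  ((1 + c *: 'X) ^+ m)`_j = c ^+ j * 'C(m, j)%:R.
Proof.
have -> : (1 + c *: 'X) ^+ m = \poly_(i < m.+1) (c ^+ i * 'C(m, i)%:R).
  rewrite exprDn poly_def; apply: eq_bigr => i _.
  by rewrite expr1n mul1r exprZn -scaler_nat scalerA mulrC.
rewrite coef_poly ltnS; case: leqP => // mj.
by rewrite bin_small // mulr0.
Qed.

(** The generating function of the Krawtchouk values at an integer [k]: the
    defining sum is a product of two binomial expansions. *)
Lemma horner_krawtchouk w n (Q : R) k : (k <= n)%N ->
  (krawtchouk w n Q).[k%:R] =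
  ((1 - 'X) ^+ k * (1 + (Q - 1) *: 'X) ^+ (n - k))`_w.
Proof.
move=> kn; rewrite coefM /krawtchouk horner_sum; apply: eq_bigr => j _.
rewrite -[in RHS](scaleN1r 'X) !coef_linear_exp hornerZ hornerM horner_comp.
rewrite hornerD hornerC hornerN hornerX -natrB // !horner_binp; ring.
Qed.

(** The evaluation point is [P_1(k)], which the inverse of [P_1] sends back to
    [k]. *)
Lemma horner_Pi_poly w n (Q : R) k : Q != 0 -> (k <= n)%N ->
  (Pi_poly w n Q).[(Q - 1) * n%:R - Q * k%:R] =
  ((1 - 'X) ^+ k * (1 + (Q - 1) *: 'X) ^+ (n - k))`_w.
Proof.
move=> Q0 kn; rewrite /Pi_poly horner_comp /krawtchouk1_inv.
rewrite -horner_krawtchouk //; congr (_.[_]); rewrite !hornerE.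
by field.
Qed.

End KrawtchoukValues.

(** * Functions of a matrix at an eigenvector *)

Section MatrixFunctionsOnEigenvectors.

Lemma eigenvector_horner_mx (R : comNzRingType) m (M : 'M[R]_m.+1) (a : R)
    (g : 'rV[R]_m.+1) (P : {poly R}) :
  g *m M = a *: g -> g *m horner_mx M P = P.[a] *: g.
Proof.
move=> gM; elim/poly_ind: P => [|P c IH].
  by rewrite rmorph0 mulmx0 horner0 scale0r.
rewrite rmorphD rmorphM /= horner_mx_X horner_mx_C mulmxDr mul_mx_scalar.
by rewrite mulmxA IH -scalemxAl gM scalerA !hornerE scalerDl.
Qed.

Variables (R : realType) (m : nat).
Implicit Types (M : 'M[R]_m.+1) (g : 'rV[R]_m.+1).

Lemma eigenvector_exp M g (a : R) k :
  g *m M = a *: g -> g *m M ^+ k = a ^+ k *: g.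
Proof.
move=> gM; elim: k => [|k IH]; first by rewrite mulmx1 scale1r.
rewrite exprSr -[X in g *m X]/(M ^+ k *m M) mulmxA IH -scalemxAl gM scalerA.
by rewrite -exprSr.
Qed.

Lemma cvg_matrix (u : nat -> 'M[R]_m.+1) (L : 'M[R]_m.+1) :
  (forall i j, (fun k => u k i j) @ \oo --> L i j)%classic ->
  (u @ \oo --> L)%classic.
Proof.
move=> uL; apply/cvg_ballP => e e0.
have : (\forall k \near \oo, forall ij : 'I_m.+1 * 'I_m.+1,
    ball (L ij.1 ij.2) e (u k ij.1 ij.2))%classic.
  apply: filter_forall => -[i j] /=.
  by have /cvg_ballP := uL i j; apply.
apply: filterS => k ballk; split => // i j; exact: (ballk (i, j)).
Qed.

(** The sum of the absolute values of all entries is submultiplicative; this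
    makes every entry of the exponential series converge absolutely. *)
Lemma normr_exp_entry M k i j :
  `|(M ^+ k) i j| <= (\sum_i \sum_j `|M i j|) ^+ k.
Proof.
set c := \sum_i \sum_j `|M i j|.
have c0 : 0 <= c by do 2!apply: sumr_ge0 => ? _.
elim: k i j => [|k IH] i j.
  by rewrite mxE; case: eqP; rewrite ?normr1 ?normr0 ?expr0 ?ler01.
rewrite !exprSr mxE (le_trans (ler_norm_sum _ _ _)) //.
apply: (@le_trans _ _ (\sum_l c ^+ k * `|M l j|)).
  by apply: ler_sum => l _; rewrite normrM ler_wpM2r.
rewrite -mulr_sumr ler_wpM2l ?exprn_ge0 //; apply: ler_sum => l _.
by rewrite (bigD1 j) //= lerDl sumr_ge0.
Qed.

Lemma cvg_expmx_entry M i j :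
  cvgn (series (fun k : nat => (k`!%:R)^-1 * (M ^+ k) i j)).
Proof.
apply: normed_cvg; apply: (@series_le_cvg _ _
  (exp_coeff (\sum_i \sum_j `|M i j|))) => [k|k|k|].
- exact: normr_ge0.
- rewrite /exp_coeff /= divr_ge0 // exprn_ge0 //.
  by do 2!apply: sumr_ge0 => ? _.
- rewrite /= normrM ger0_norm ?invr_ge0 // mulrC ler_wpM2r ?invr_ge0 //.
  exact: normr_exp_entry.
- exact: is_cvg_series_exp_coeff.
Qed.

(** Entrywise convergence is convergence of matrices, so the limit that defines
    the exponential exists and can be computed entry by entry. *)
Lemma expmx_cvg M i j :
  (series (fun k : nat => (k`!%:R)^-1 * (M ^+ k) i j) @ \oo
    --> expmx M i j)%classic.
Proof.
pose L : 'M[R]_m.+1 :=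
  \matrix_(i, j) limn (series (fun k : nat => (k`!%:R)^-1 * (M ^+ k) i j)).
suff -> : expmx M = L by rewrite mxE; exact: cvg_expmx_entry.
apply/cvg_lim; first exact: norm_hausdorff.
apply: cvg_matrix => {}i {}j; rewrite mxE.
have -> : (fun k => series (fun k : nat => (k`!%:R)^-1 *: M ^+ k) k i j)
          = series (fun k : nat => (k`!%:R)^-1 * (M ^+ k) i j).
  apply/funext => k; rewrite /series /= summxE.
  by apply: eq_bigr => l _; rewrite mxE.
exact: cvg_expmx_entry.
Qed.

(** Applied to [g], the partial sums of the matrix series become those of the
    scalar exponential series times [g]. *)
Lemma eigenvector_expmx M g (a : R) :
  g *m M = a *: g -> g *m expmx M = expR a *: g.
Proof.
move=> gM; apply/rowP => j; rewrite !mxE.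
pose u k := \sum_i g 0 i *
   series (fun k : nat => (k`!%:R)^-1 * (M ^+ k) i j) k.
have u_cvg : (u @ \oo --> \sum_i g 0 i * expmx M i j)%classic.
  apply: cvg_big => [|i _]; first exact: add_continuous.
  by apply: cvgMl_tmp; exact: expmx_cvg.
have uE : u = (fun k => series (exp_coeff a) k * g 0 j).
  apply/funext => k; rewrite /u /series /= mulr_suml.
  under eq_bigr do rewrite mulr_sumr.
  rewrite exchange_big; apply: eq_bigr => l _ /=.
  transitivity ((l`!%:R)^-1 * (g *m M ^+ l) 0 j).
    rewrite mxE mulr_sumr; apply: eq_bigr => i _; ring.
  by rewrite (eigenvector_exp _ gM) mxE /exp_coeff /=; ring.
rewrite uE in u_cvg; apply: (cvg_unique _ u_cvg) => //.
by apply: cvgMr_tmp; exact: is_cvg_series_exp_coeff.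
Qed.

Lemma eigenvector_powmx (t : R) M g k : 0 < t ->
  g *m M = k%:R *: g -> g *m powmx t M = t ^+ k *: g.
Proof.
move=> t0 gM; rewrite /powmx (@eigenvector_expmx _ _ (ln t * k%:R)).
  by rewrite expRM_natr lnK.
by rewrite -scalemxAr gM scalerA.
Qed.

(** When [M] acts on [g] as [P_1(k)], its two exponents in [Zmx] act as the
    integers [k] and [n - k]. *)
Lemma eigenvector_Zmx M g n k (Q z : R) :
  Q != 0 -> (k <= n)%N -> 0 < 1 - z -> 0 < 1 + (Q - 1) * z ->
  g *m M = ((Q - 1) * n%:R - Q * k%:R) *: g ->
  g *m Zmx M n Q z =
    ((1 - z) ^+ k * (1 + (Q - 1) * z) ^+ (n - k)) *: g.
Proof.
move=> Q_neq0 kn z1 zr gM; rewrite /Zmx mulmxA.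
rewrite (@eigenvector_powmx (1 - z) _ _ k) //.
  rewrite -scalemxAl (@eigenvector_powmx _ _ _ (n - k)) ?scalerA //.
  rewrite -scalemxAr mulmxDr mul_mx_scalar gM -scalerDl scalerA natrB //.
  by congr (_ *: _); field.
rewrite -scalemxAr mulmxBr mul_mx_scalar gM -scalerBl scalerA.
by congr (_ *: _); field.
Qed.

End MatrixFunctionsOnEigenvectors.

(** * Decomposition of a perfect structure along the subcube *)

Lemma card_notin (I : finType) (K : {set I}) :
  #|[pred i | i \notin K]| = (#|I| - #|K|)%N.
Proof. by rewrite -(cardC (mem K)) addKn; apply: eq_card. Qed.

Lemma prodr_in_set (A : comNzRingType) (I : finType) (K : {set I}) (x y : A) :
  \prod_i (if i \in K then x else y) = x ^+ #|K| * y ^+ (#|I| - #|K|).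
Proof.
rewrite -card_notin -!prodr_const (bigID (mem K)) /=; congr (_ * _).
  by apply: eq_bigr => i ->.
by apply: eq_big => // i /negPf ->.
Qed.

Section SubcubeCharacters.
Variables (R : realType) (p q n : nat).
Hypotheses (p_gt0 : (0 < p)%N) (lt_pq : (p < q)%N).
Let Q : R := q%:R / p%:R.

Let p_neq0 : p%:R != 0 :> R.
Proof. by rewrite pnatr_eq0 -lt0n. Qed.

Let Q_neq0 : Q != 0.
Proof. by rewrite mulf_neq0 ?invr_eq0 // pnatr_eq0 -lt0n (ltn_trans p_gt0). Qed.

(** Orthogonal to the constants, and constant on the subalphabet and on its
    complement: up to a scalar, the only such function of the letters. *)
Definition letter_char (c : 'I_q) : R := if (c < p)%N then Q - 1 else -1.

Definition subcube_char (K : {set 'I_n}) (v : word q n) : R :=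
  \prod_i (if i \in K then letter_char (v i) else 1).

Lemma sum_letter_char : \sum_c letter_char c = 0.
Proof.
rewrite -(big_mkord xpredT (fun c => if (c < p)%N then Q - 1 else -1)).
rewrite (big_cat_nat (n := p)) //=; last exact: ltnW.
rewrite (@eq_big_nat _ _ _ 0 p _ (fun=> Q - 1)); last by move=> i /andP[_ ->].
rewrite (@eq_big_nat _ _ _ p q _ (fun=> -1)); last first.
  by move=> i /andP[/leq_gtF -> _].
rewrite !sumr_const_nat subn0 -(mulr_natr (Q - 1)) -(mulr_natr (-1)) natrB.
  by rewrite /Q; field.
exact: ltnW.
Qed.

(** A coordinate contributes -1 if it is in [K], since the letter function
    has sum 0, and the degree [q - 1] otherwise. *)
Lemma subcube_char_eigen K v :
  \sum_(u | cube_adj u v) subcube_char K u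
    = ((q%:R - 1) * n%:R - q%:R * #|K|%:R) * subcube_char K v.
Proof.
pose psi i c := if i \in K then letter_char c else 1.
pose lambda (i : 'I_n) : R := q%:R * (i \notin K)%:R - 1.
rewrite (cube_tensor_eigen (psi := psi) (lambda := lambda)).
  congr (_ * _); rewrite /lambda big_split /= -mulr_sumr.
  rewrite -natr_sum sumrN sumr_const card_ord -big_mkcond sum1_card.
  rewrite card_notin card_ord natrB; first ring.
  by rewrite -[leqRHS]card_ord; apply: max_card.
move=> i b; rewrite /psi /lambda; case: (i \in K) => /=.
  have := sum_letter_char; rewrite (bigD1 b) //= addrC => /eqP.
  by rewrite addr_eq0 mulr0 sub0r mulN1r => /eqP.
rewrite !mulr1 sumr_const (cardC1 b) card_ord -subn1 natrB //.
exact: ltn_trans lt_pq.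
Qed.

(** Each coordinate of [v] contributes the factor 1 or 'X, and both of them
    are of the form [Q^-1 (c (1 - 'X) + (1 + (Q - 1) 'X))], with [c] equal
    to [Q - 1] in the first case and to -1 in the second, that is to the
    value of [letter_char]. It remains to expand the product. *)
Lemma weight_monomialE v :
  'X^(weight p v) =
  \sum_(K : {set 'I_n}) (Q ^- n * subcube_char K v) *:
    ((1 - 'X) ^+ #|K| * (1 + (Q - 1) *: 'X) ^+ (n - #|K|)) :> {poly R}.
Proof.
pose a : {poly R} := Q^-1 *: (1 - 'X).
pose b : {poly R} := Q^-1 *: (1 + (Q - 1) *: 'X).
transitivity (\prod_i (letter_char (v i) *: a + b)).
  rewrite weightE expr_sum; apply: eq_bigr => i _.
  have QV : (Q^-1)%:P * (1 + (Q - 1)%:P) = 1 :> {poly R}.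
    by rewrite -polyC1 -polyCD -polyCM addrC subrK mulVf.
  rewrite /letter_char /a /b leqNgt -!mul_polyC; case: ifP => _ /=.
    by rewrite expr0 -[LHS]QV; ring.
  by rewrite expr1 -['X in LHS]mul1r -QV polyCN; ring.
rewrite bigA_distr; apply: eq_bigr => K _.
pose s i := Q^-1 * (if i \in K then letter_char (v i) else 1).
pose m i : {poly R} := if i \in K then 1 - 'X else 1 + (Q - 1) *: 'X.
transitivity (\prod_i (s i *: m i)).
  apply: eq_bigr => i _; rewrite /s /m /a /b.
  by case: (i \in K); rewrite ?mulr1 // scalerA mulrC.
rewrite scaler_prod prodr_in_set card_ord big_split /= prodr_const card_ord.
by rewrite exprVn.
Qed.

Variables (nu : nat) (S : 'M[R]_nu.+1) (f : 'M[R]_(#|{: word q n}|, nu.+1)).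
Hypothesis fS : perfect_structure (@cube_adj q n) S f.

(** The contribution of [K] to the weight enumerator is this vector times
    [(1 - 'X)^|K| (1 + (Q - 1) 'X)^(n - |K|)]; its scaling makes the vectors of
    all the sets [K] add up to the sum of [f] over the subcube. *)
Definition char_component (K : {set 'I_n}) : 'rV[R]_nu.+1 :=
  Q ^- n *: \sum_v subcube_char K v *: at_vertex f v.

Let S' : 'M[R]_nu.+1 := p%:R^-1 *: (S - ((p%:R - 1) * n%:R)%:M).

Lemma char_component_eigen K :
  char_component K *m S' = ((Q - 1) * n%:R - Q * #|K|%:R) *: char_component K.
Proof.
rewrite /char_component -scalemxAl scalerA mulrC -scalerA; congr (_ *: _).
rewrite /S' -scalemxAr mulmxBr mul_mx_scalar.
rewrite (perfect_structure_eigen fS (subcube_char_eigen K)) -scalerBl scalerA.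
by congr (_ *: _); rewrite /Q; field.
Qed.

(** The decomposition of the weight enumerator, seen through a linear form
    [h] on polynomials. Taking a coefficient for [h] gives the weight
    distribution, and evaluation at a point gives the weight enumerator. *)
Lemma at_vertex_sum_weight (h : {scalar {poly R}}) :
  \sum_v h 'X^(weight p v) *: at_vertex f v =
  \sum_(K : {set 'I_n})
    h ((1 - 'X) ^+ #|K| * (1 + (Q - 1) *: 'X) ^+ (n - #|K|))
      *: char_component K.
Proof.
under eq_bigr do rewrite weight_monomialE linear_sum scaler_suml.
rewrite exchange_big; apply: eq_bigr => K _ /=.
rewrite /char_component scalerA scaler_sumr; apply: eq_bigr => v _.
by rewrite linearZ /= scalerA; congr (_ *: _); ring.
Qed.

End SubcubeCharacters.

Theorem theorem7 (R : realType) (p q n nu : nat)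
    (S : 'M[R]_nu.+1) (f : 'M[R]_(#|{: word q n}|, nu.+1)) :
  (0 < p)%N -> (p < q)%N ->
  perfect_structure (@cube_adj q n) S f ->
  let C := subcube p q n in
  let Q : R := q%:R / p%:R in
  let S' := p%:R^-1 *: (S - ((p%:R - 1) * n%:R)%:M) in
  let f0 := \sum_(v in C) at_vertex f v in
  [/\ f0 = f0 *m horner_mx S' (Pi_poly 0 n Q),
      weight_distribution (@cube_adj q n) C f =
        [seq f0 *m horner_mx S' (Pi_poly i n Q) | i <- iota 0 n.+1]
    & forall z : R, 0 < 1 - z -> 0 < 1 + (Q - 1) * z ->
        weight_enumerator (@cube_adj q n) C f z = f0 *m Zmx S' n Q z].
Proof.
move=> p_gt0 lt_pq fS C Q S' f0.
have Q_neq0 : Q != 0.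
  by rewrite mulf_neq0 ?invr_eq0 ?pnatr_eq0 -?lt0n // (ltn_trans p_gt0).
have K_le (K : {set 'I_n}) : (#|K| <= n)%N.
  by rewrite -[leqRHS]card_ord; apply: max_card.
pose G := char_component p f; pose r := Q - 1.
pose m (K : {set 'I_n}) : {poly R} :=
  (1 - 'X) ^+ #|K| * (1 + r *: 'X) ^+ (n - #|K|).
have GS K : G K *m S' = ((Q - 1) * n%:R - Q * #|K|%:R) *: G K.
  exact: char_component_eigen.
pose h w := \sum_(v : word q n | weight p v == w) at_vertex f v.
have hE w : h w = \sum_K (m K)`_w *: G K.
  rewrite -(at_vertex_sum_weight p_gt0 lt_pq f (coefp w)) /h big_mkcond /=.
  apply: eq_bigr => v _; rewrite coefXn eq_sym.
  by case: eqP; rewrite ?scale1r ?scale0r.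
have f0E : f0 = \sum_K G K.
  have -> : f0 = h 0%N by apply: eq_bigl => v; rewrite weight_eq0.
  rewrite hE; apply: eq_bigr => K _.
  (* A constant coefficient is a value at 0, where both factors are 1. *)
  by rewrite -horner_coef0 /m !hornerE !(subr0, expr1n, mul1r, scale1r).
have hPi w : h w = f0 *m horner_mx S' (Pi_poly w n Q).
  rewrite f0E mulmx_suml hE; apply: eq_bigr => K _.
  by rewrite (eigenvector_horner_mx _ (GS K)) horner_Pi_poly.
have wdE :
  weight_distribution (@cube_adj q n) C f = [seq h w | w <- iota 0 n.+1].
  rewrite /weight_distribution covering_radius_subcube //.
  apply: eq_map => w; apply: eq_bigl => v.
  by rewrite set_dist_subcube.
split.
- by rewrite -hPi; apply: eq_bigl => v; rewrite weight_eq0.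
- by rewrite wdE; apply: eq_map.
- move=> z z1 zr; rewrite /weight_enumerator wdE size_map size_iota.
  transitivity (\sum_(v : word q n) ('X^(weight p v)).[z] *: at_vertex f v).
    (* Weights are at most n, so inord does not truncate. *)
    rewrite (partition_big (fun v => inord (weight p v) : 'I_n.+1) xpredT) //.
    apply: eq_bigr => w _; rewrite (nth_map 0%N) ?size_iota // nth_iota //.
    rewrite add0n /h scaler_sumr; apply: eq_big => [v|v /eqP <-].
      by rewrite -val_eqE /= inordK // ltnS weight_le.
    by rewrite hornerXn.
  rewrite (at_vertex_sum_weight p_gt0 lt_pq f (horner_eval z)).
  rewrite f0E mulmx_suml; apply: eq_bigr => K _.
  rewrite (eigenvector_Zmx Q_neq0 (K_le K) z1 zr (GS K)); congr (_ *: _).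
  by rewrite /= /horner_eval !hornerE.
Qed.
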